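(* As $n \to \infty$, $$(1-o(1))\,n^3 \leq \mathrm{sat}(n,C_6,K_5) \leq 6\binom{n-3}{3}.$$
   Context: All graphs are finite and simple. A graph $G$ is $F$-free if it contains no (not necessarily induced) subgraph isomorphic to $F$. $G$ is $F$-saturated if $G$ is $F$-free but adding any nonedge to $G$ creates at least one copy of $F$. A copy of $H$ in $G$ is a (not necessarily induced) subgraph of $G$ isomorphic to $H$. $\mathrm{sat}(n,H,F)$ denotes the minimum number of copies of $H$ in an $n$-vertex $F$-saturated graph. $K_m$ is the complete graph on $m$ vertices and $C_m$ is the cycle on $m$ vertices. *)

(* Defs.v *)
From HB Require Import structures.
From mathcomp Require Import all_boot.

Set Implicit Arguments.
Unset Strict Implicit.
Unset Printing Implicit Defensive.

Record sgraph (V : finType) := SGraph {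
  edges :> {set {set V}};
  edges_card2 : [forall e in edges, #|e| == 2]
}.

HB.instance Definition _ (V : finType) := [isSub for @edges V].
HB.instance Definition _ (V : finType) := [Finite of sgraph V by <:].

Lemma graph_of_subproof (V : finType) (A : {set {set V}}) :
  [forall e in [set e in A | #|e| == 2], #|e| == 2].
Proof. by apply/forall_inP => e; rewrite inE => /andP[]. Qed.

(* Members of A that are not 2-element sets are discarded. *)
Definition graph_of (V : finType) (A : {set {set V}}) : sgraph V :=
  SGraph (graph_of_subproof A).

Definition complete_graph (m : nat) : sgraph 'I_m := graph_of [set: {set 'I_m}].

(* ordS is the successor modulo m; this is the cycle C_m when 3 <= m. *)
Definition cycle_graph (m : nat) : sgraph 'I_m :=
  graph_of [set [set i; ordS i] | i : 'I_m].

Definition add_edge (V : finType) (G : sgraph V) (x y : V) : sgraph V :=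
  graph_of ([set x; y] |: G).

(* A subgraph is a pair (vertex set, edge set); it is isomorphic to H exactly
   when it is the image of H under an injection f of the vertices of H. *)
Definition copies (U V : finType) (H : sgraph U) (G : sgraph V) :
    {set {set V} * {set {set V}}} :=
  [set S : {set V} * {set {set V}} | (S.2 \subset edges G) &&
    [exists f : {ffun U -> V},
      [&& injectiveb f, S.1 == f @: [set: U] &
          S.2 == [set f @: (e : {set U}) | e in edges H]]]].

Definition ncopies (U V : finType) (H : sgraph U) (G : sgraph V) : nat :=
  #|copies H G|.

Definition F_free (U V : finType) (F : sgraph U) (G : sgraph V) : bool :=
  copies F G == set0.

Definition saturated (U V : finType) (F : sgraph U) (G : sgraph V) : bool :=
  F_free F G &&
  [forall x, forall y, (x != y) && ([set x; y] \notin edges G) ==>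
    ~~ F_free F (add_edge G x y)].

(* The default value ncopies H (complete_graph n) bounds ncopies H G for every
   G on n vertices, so this is the minimum as soon as some F-saturated graph on
   n vertices exists; see satP and saturated_exists. *)
Definition sat (n : nat) (U W : finType) (H : sgraph U) (F : sgraph W) : nat :=
  \big[minn/ncopies H (complete_graph n)]_(G : sgraph 'I_n | saturated F G)
    ncopies H G.

Lemma sgraph_edge_card (V : finType) (G : sgraph V) (e : {set V}) :
  e \in edges G -> #|e| = 2.
Proof. by move=> eG; apply/eqP; apply: (forall_inP (edges_card2 G)). Qed.

Lemma ncopies_mono (U V : finType) (H : sgraph U) (G G' : sgraph V) :
  edges G \subset edges G' -> ncopies H G <= ncopies H G'.
Proof.
move=> sGG'; apply: subset_leq_card; apply/subsetP => S.
by rewrite !inE => /andP[sSG ->]; rewrite (subset_trans sSG sGG').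
Qed.

Lemma sub_complete_graph (n : nat) (G : sgraph 'I_n) :
  edges G \subset edges (complete_graph n).
Proof.
by apply/subsetP => e eG; rewrite /= !inE /= (sgraph_edge_card eG).
Qed.

Lemma sat_min (n : nat) (U W : finType) (H : sgraph U) (F : sgraph W)
    (G : sgraph 'I_n) :
  saturated F G -> sat n H F <= ncopies H G.
Proof.
move=> sG; rewrite /sat; have := mem_index_enum G.
elim: (index_enum _) => // G' r IHr; rewrite inE big_cons => /orP[/eqP <-|/IHr].
  by rewrite sG geq_minl.
by case: ifP => // _; apply/leq_trans/geq_minr.
Qed.

Lemma satP (n : nat) (U W : finType) (H : sgraph U) (F : sgraph W) :
    (exists G : sgraph 'I_n, saturated F G) ->
  (exists2 G : sgraph 'I_n, saturated F G & ncopies H G = sat n H F) /\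
  (forall G : sgraph 'I_n, saturated F G -> sat n H F <= ncopies H G).
Proof.
case=> G0 sG0; split; last by move=> G; apply: sat_min.
case: (arg_minnP (fun G : sgraph 'I_n => ncopies H G) sG0) => G sG minG.
exists G => //; apply/eqP; rewrite eqn_leq sat_min // andbT /sat.
elim/big_ind: _ => [|a b ha hb|G' sG']; last exact: minG.
  exact/ncopies_mono/sub_complete_graph.
by rewrite leq_min ha.
Qed.

Lemma saturated_exists (n : nat) (W : finType) (F : sgraph W) :
  edges F != set0 -> exists G : sgraph 'I_n, saturated F G.
Proof.
move=> F_neq0; pose G0 : sgraph 'I_n := graph_of set0.
have G0free : F_free F G0.
  apply/eqP/setP => S; rewrite !inE; apply/negbTE/negP => /andP[sS0].
  case/existsP => f /and3P[_ _ /eqP S2]; case/set0Pn: F_neq0 => e eF.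
  have : f @: e \in S.2 by rewrite S2; apply/imsetP; exists e.
  by move/(subsetP sS0); rewrite !inE.
case: (arg_maxnP (fun G : sgraph 'I_n => #|edges G|) G0free) => G Gfree maxG.
exists G; rewrite /saturated Gfree; apply/forallP => x; apply/forallP => y.
apply/implyP => /andP[neq_xy xyG]; apply/negP => /maxG.
rewrite /= leqNgt => /negP[]; apply: proper_card; apply/properP; split.
  apply/subsetP => e eG.
  by rewrite /= !inE eG orbT (sgraph_edge_card eG).
by exists [set x; y]; rewrite //= !inE eqxx /= cards2 neq_xy.
Qed.

(* Main.v *)
Require Import Defs.
From mathcomp Require Import all_boot all_order all_algebra zify.
Set Implicit Arguments.
Unset Strict Implicit.
Unset Printing Implicit Defensive.

(** Upper bound: in the join of a triangle and an independent set, every 6-cycle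
alternates between the triangle and three of the n - 3 other vertices, and three
such vertices lie in exactly 6 of these cycles.

Lower bound: two nonadjacent vertices of a K_5-saturated graph G have at least
three common neighbours (saturated_cn). So if x, y, z are pairwise nonadjacent,
choosing distinct common neighbours a of x and y, b of y and z, c of z and x gives
a 6-cycle x a y b z c, and three sets of size at least 3 have at least 6 systems of
distinct representatives. If G has o(n^2) edges, almost all of the n^3 / 6 triples
are independent, which gives n^3 6-cycles, except that a cycle can be found from
both of its alternating triples. The proof has to recover this factor of 2.

Call a path x v y a cherry; their number is governed by the sum of the squares of
the degrees.

If that sum is O(n^2), let L be the set of the vertices of degree at most n / p
for a large constant p. All but O(1) vertices are in L, almost all triples inside
L are independent, and almost none has a common neighbour in L. Consider such a
triple x, y, z. If one of the three sets of common neighbours avoids L, then every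
choice of a, b, c leaves L, and the 6 cycles are seen from only one triple inside L.
Otherwise each of the three sets contains a vertex of L, which belongs to neither of
the other two sets; then there are at least 12 systems of representatives, which
makes up for counting each cycle twice (typical_hex, hexes_few_cherries).

If the sum exceeds a large multiple of n^2 and few vertices have degree at least
n / 3, then most cherries x v y have two ends of smaller degree, and each of the
roughly n / 3 vertices z nonadjacent to both ends closes the cherry to a 6-cycle
(hexes_cherries).

If many vertices have degree at least n / 3, convexity produces 6-cycles among them
and their common neighbours, as many as a large multiple of n^3 (hexes_dense). *)

(** * Copies and embeddings *)

(** Injective homomorphisms from H to G. Several of them may have the same
image, so counting copies of H amounts to counting embeddings up to the
automorphisms of H, which are the embeddings of H in itself. *)
Definition embeddings (U V : finType) (H : sgraph U) (G : sgraph V) :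
    {set {ffun U -> V}} :=
  [set f : {ffun U -> V} | injectiveb f &
     [forall e in edges H, f @: (e : {set U}) \in edges G]].

Definition copy_of (U V : finType) (H : sgraph U) (f : {ffun U -> V}) :
    {set V} * {set {set V}} :=
  (f @: [set: U], [set f @: (e : {set U}) | e in edges H]).

Lemma copiesE (U V : finType) (H : sgraph U) (G : sgraph V) :
  copies H G = copy_of H @: embeddings H G.
Proof.
apply/setP => -[S1 S2]; rewrite inE /=; apply/andP/imsetP.
  case=> sSG /existsP[f /and3P[f_inj /eqP S1E /eqP S2E]]; exists f; last first.
    by rewrite /copy_of -S1E -S2E.
  rewrite inE f_inj; apply/forall_inP => e eH; apply: (subsetP sSG).
  by rewrite S2E; apply: imset_f.
case=> f; rewrite inE => /andP[f_inj /forall_inP fG] [-> ->]; split.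
  by apply/subsetP => _ /imsetP[e eH ->]; apply: fG.
by apply/existsP; exists f; rewrite f_inj !eqxx.
Qed.

(** Two embeddings with the same image differ by an automorphism of H. *)
Lemma copy_of_fiber (U V : finType) (H : sgraph U) (G : sgraph V) f :
  f \in embeddings H G ->
  #|[set g in embeddings H G | copy_of H g == copy_of H f]| = #|embeddings H H|.
Proof.
rewrite inE => /andP[/injectiveP f_inj /forall_inP fG].
pose F (s : {ffun U -> U}) := [ffun u => f (s u)].
have F_inj : injective F.
  by move=> s t /ffunP eq_st; apply/ffunP => u; apply: f_inj;
     have := eq_st u; rewrite !ffunE.
have FE s (e : {set U}) : F s @: e = f @: (s @: e).
  by rewrite -imset_comp; apply: eq_imset => u; rewrite ffunE.
rewrite -(card_imset _ F_inj); congr #|pred_of_set _|; apply/setP => g.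
rewrite 2!inE; apply/andP/imsetP.
  case=> /andP[/injectiveP g_inj _] /eqP[img imE].
  have im u : exists v, g u == f v.
    have : g u \in g @: [set: U] by apply: imset_f.
    by rewrite img => /imsetP[v _ ->]; exists v.
  pose s := [ffun u => xchoose (im u)].
  have sE u : f (s u) = g u by rewrite ffunE -(eqP (xchooseP (im u))).
  have gE : g = F s by apply/ffunP => u; rewrite ffunE sE.
  exists s => //; rewrite inE; apply/andP; split.
    by apply/injectiveP => u v eq_s; apply: g_inj; rewrite -!sE eq_s.
  apply/forall_inP => e eH.
  have : g @: e \in [set g @: (e : {set U}) | e in edges H] by apply: imset_f.
  by rewrite imE gE FE => /imsetP[e' e'H /(imset_inj f_inj) ->].
case=> s; rewrite inE => /andP[/injectiveP s_inj /forall_inP sH] ->.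
(* An injective edge-preserving self-map of a finite graph is bijective on
   vertices and on edges. *)
have sbij : s @: [set: U] = [set: U].
  by apply/eqP; rewrite eqEcard subsetT (card_imset _ s_inj) leqnn.
have sE : [set s @: (e : {set U}) | e in edges H] = edges H.
  apply/eqP; rewrite eqEcard (card_imset _ (imset_inj s_inj)) leqnn andbT.
  by apply/subsetP => _ /imsetP[e eH ->]; apply: sH.
split.
  apply/andP; split.
    by apply/injectiveP => u v; rewrite !ffunE => /f_inj/s_inj.
  by apply/forall_inP => e eH; rewrite FE fG ?sH.
rewrite /copy_of FE sbij -{2}sE -imset_comp; apply/eqP; congr pair.
by apply: eq_imset => e /=; rewrite FE.
Qed.

Lemma card_embeddings (U V : finType) (H : sgraph U) (G : sgraph V) :
  #|embeddings H G| = #|embeddings H H| * ncopies H G.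
Proof.
rewrite /ncopies copiesE -sum1_card (partition_big_imset (copy_of H)) /=.
rewrite mulnC -sum_nat_const; apply: eq_bigr => _ /imsetP[f fE ->].
rewrite sum1dep_card -(copy_of_fiber fE).
by apply: eq_card => g; rewrite !inE.
Qed.

(** * Adjacency and neighbourhoods *)

Section Adjacency.
Variables (V : finType) (G : sgraph V).

Definition adj (x y : V) := [set x; y] \in edges G.

Lemma adj_sym x y : adj x y = adj y x.
Proof. by rewrite /adj setUC. Qed.

Lemma adj_irr x : adj x x = false.
Proof. by apply/negP => /sgraph_edge_card; rewrite setUid cards1. Qed.

Lemma adj_neq x y : adj x y -> x != y.
Proof. by apply: contraTneq => ->; rewrite adj_irr. Qed.

Definition nbr x : {set V} := [set y | adj x y].
Definition cn x y : {set V} := nbr x :&: nbr y.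
Definition deg x := #|nbr x|.

End Adjacency.

(** * Automorphisms of cycles *)

Lemma cycle_embeddingP (m : nat) (V : finType) (G : sgraph V)
    (f : {ffun 'I_m.+2 -> V}) :
  reflect (injective f /\ forall i, adj G (f i) (f (ordS i)))
          (f \in embeddings (cycle_graph m.+2) G).
Proof.
have neqS (i : 'I_m.+2) : i != ordS i.
  rewrite -val_eqE /=; case: (ltngtP i.+1 m.+2) (ltn_ord i) => // [lt_i _|[->] _].
    by rewrite modn_small // neq_ltn ltnSn.
  by rewrite modnn.
rewrite inE; apply: (iffP andP) => -[/injectiveP f_inj fG]; split => //.
  move=> i; have := forall_inP fG [set i; ordS i].
  rewrite inE cards2 neqS andbT (imset_f (fun i => [set i; ordS i])) // => /(_ isT).
  by rewrite imsetU1 imset_set1.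
apply/forall_inP => e; rewrite !inE => /andP[/imsetP[i _ ->] _].
by rewrite imsetU1 imset_set1; apply: fG.
Qed.

Section CycleAutomorphisms.
Import GRing.Theory.
Local Open Scope ring_scope.

(** Identify the vertices with the integers modulo m + 3. An automorphism moves
each step i, i + 1 to a step of +1 or -1; injectivity forbids turning back, so
the sign is constant and the automorphism is the affine map
i |-> f 0 + i or i |-> f 0 - i. *)
Lemma card_cycle_aut (m : nat) :
  #|embeddings (cycle_graph m.+3) (cycle_graph m.+3)| = 2 * m.+3.
Proof.
have ordSE (i : 'I_m.+3) : ordS i = i + 1.
  by apply: val_inj; rewrite /= modnDmr addn1.
(* This is where a cycle length of at least 3 matters. *)
have two0 : (1 + 1 : 'I_m.+3) != 0 by [].
pose sg (b : bool) : 'I_m.+3 := if b then 1 else - 1.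
have adjP (i j : 'I_m.+3) :
    adj (cycle_graph m.+3) i j -> exists b, j = i + sg b.
  rewrite /adj !inE => /andP[/imsetP[k _ ijE] card2].
  have neq : i != j by move: card2; rewrite cards2; case: (i == j).
  have : i \in [set k; ordS k] by rewrite -ijE set21.
  have : j \in [set k; ordS k] by rewrite -ijE set22.
  rewrite !inE ordSE => /orP[]/eqP jE /orP[]/eqP iE.
  - by rewrite iE jE eqxx in neq.
  - by exists false; rewrite iE jE addrK.
  - by exists true; rewrite iE jE.
  - by rewrite iE jE eqxx in neq.
have adj_sg (i : 'I_m.+3) b : adj (cycle_graph m.+3) i (i + sg b).
  have adjS (k : 'I_m.+3) : adj (cycle_graph m.+3) k (k + 1).
    have neq : k != k + 1 by rewrite eq_sym -subr_eq0 addrAC subrr add0r.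
    by rewrite /adj inE cards2 neq -ordSE (imset_f (fun i => [set i; ordS i])).
  by case: b => //=; rewrite adj_sym -{2}[i](subrK 1).
pose F (p : 'I_m.+3 * bool) := [ffun i : 'I_m.+3 => p.1 + sg p.2 * i].
have sg_inj : injective sg.
  have neq : 1 != - 1 :> 'I_m.+3 by rewrite -subr_eq0 opprK.
  by case=> [][] //= /eqP; rewrite ?(negPf neq) // eq_sym (negPf neq).
have F_inj : injective F.
  move=> [i b] [j c] /ffunP eqF; have := eqF 0; rewrite !ffunE /= !mulr0 !addr0.
  by move=> ij; have := eqF 1; rewrite !ffunE /= !mulr1 ij => /addrI/sg_inj->.
suff -> : embeddings (cycle_graph m.+3) (cycle_graph m.+3) = F @: setT.
  by rewrite card_imset // cardsT card_prod card_ord card_bool mulnC.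
apply/setP => f; apply/cycle_embeddingP/imsetP; last first.
  case=> -[i b] _ ->; split; last first.
    move=> j; rewrite !ffunE ordSE /= mulrDr mulr1 addrA; exact: adj_sg.
  move=> j k; rewrite !ffunE /= => /addrI.
  by case: b => /=; rewrite ?mul1r ?mulN1r // => /oppr_inj.
case=> f_inj fadj.
have step i : exists b, f (i + 1) = f i + sg b by apply: adjP; rewrite -ordSE.
have [b fb] := step 0.
exists (f 0, b) => //; apply/ffunP => i; rewrite ffunE /=.
have dir k : f (k%:R + 1) = f k%:R + sg b.
  elim: k => [//|k IHk]; have [c fc] := step (k.+1)%:R.
  rewrite fc; congr (_ + sg _); apply/eqP; apply: contraT => neq_cb.
  have : f (k.+1%:R + 1) = f k%:R.
    rewrite fc -natr1 IHk -addrA; suff -> : sg b + sg c = 0 by rewrite addr0.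
    by case: (b) (c) neq_cb => [][] //= _; rewrite ?subrr ?addNr.
  move/f_inj/eqP; rewrite -natr1 -addrA -[X in _ == X]addr0.
  by rewrite (inj_eq (addrI _)) (negPf two0).
rewrite -[i]natr_Zp; elim: (val i) => [|k IHk]; first by rewrite mulr0 addr0.
by rewrite -{1}natr1 dir IHk -natr1 mulrDr mulr1 addrA.
Qed.

End CycleAutomorphisms.

(** * Counting pairs and triples *)

Lemma card_sum_pred (T : finType) (P : pred T) : #|[set x | P x]| = \sum_x P x.
Proof. by rewrite -sum1dep_card big_mkcond; apply: eq_bigr => x _; case: ifP. Qed.

Section Triples.
Variable V : finType.

Lemma card_set_pair (A B : finType) (P : A -> B -> bool) :
  #|[set p : A * B | P p.1 p.2]| = \sum_a #|[set b | P a b]|.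
Proof.
rewrite -sum1dep_card; under [RHS]eq_bigr do rewrite -sum1dep_card.
by rewrite pair_big_dep.
Qed.

Lemma sum_triple (F : V * V * V -> nat) :
  \sum_X F X = \sum_x \sum_y \sum_z F (x, y, z).
Proof.
rewrite pair_big /= pair_big /=; apply: eq_bigr; by case=> [[x y] z].
Qed.

End Triples.

(** * Systems of distinct representatives *)

Section Representatives.
Variable V : finType.
Implicit Types A B C D : {set V}.

Definition reps A B C : {set V * V * V} :=
  [set u | [&& u.1.1 \in A, u.1.2 \in B, u.2 \in C
             & uniq [:: u.1.1; u.1.2; u.2]]].

(** The number of pairs is #|A| * #|B| - #|A :&: B|, and #|A :&: B| < #|A| unless
A is contained in B. *)
Lemma card_pairs_ge A B : 0 < #|B| ->
  #|A| * #|B|.-1 + ~~ (A \subset B) <= \sum_(a in A) #|B :\ a|.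
Proof.
move=> B_gt0; have Bge a : #|B|.-1 + (a \notin B) <= #|B :\ a|.
  by rewrite (cardsD1 a B) in B_gt0 *; case: (a \in B) B_gt0 => //=; lia.
case: (boolP (A \subset B)) => [_|/subsetPn[a aA aB]] /=.
  rewrite addn0 -sum_nat_const; apply: leq_sum => a _.
  by apply: leq_trans (Bge a); apply: leq_addr.
rewrite (cardsD1 a) aA (big_setD1 a) //= mulSn addnAC.
apply: leq_add; first by rewrite (leq_trans _ (Bge a)) ?aB.
rewrite -sum_nat_const; apply: leq_sum => i _.
by apply: leq_trans (Bge i); apply: leq_addr.
Qed.

Lemma card_reps A B C :
  #|reps A B C| = \sum_(a in A) \sum_(b in B :\ a) #|(C :\ a) :\ b|.
Proof.
rewrite -sum1dep_card.
rewrite (eq_bigr (fun u => (fun a b c => 1) u.1.1 u.1.2 u.2)) //.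
rewrite [RHS]big_mkcond /= [LHS]big_mkcond sum_triple; apply: eq_bigr => a _ /=.
case: ifP => aA /=; last by rewrite big1 // => b _; rewrite big1.
rewrite [RHS]big_mkcond /=; apply: eq_bigr => b _ /=.
rewrite in_setD1; case: (boolP (b \in B)) => bB; rewrite ?andbF; last first.
  by rewrite big1.
case: (eqVneq b a) => [->|neq_ba].
  by rewrite big1 // => c _; rewrite !inE eqxx andbF.
rewrite -big_mkcond /= sum1dep_card; apply: eq_card => c; rewrite !inE /=.
rewrite negb_or eq_sym neq_ba (eq_sym a) (eq_sym b) andbT.
by rewrite andbC -andbA andbCA.
Qed.

Lemma card_reps_ge A B C : 1 < #|C| ->
  \sum_(a in A) (#|B :\ a| * (#|C :\ a|.-1) + ~~ (B :\ a \subset C :\ a))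
    <= #|reps A B C|.
Proof.
move=> C2; rewrite card_reps; apply: leq_sum => a _.
by apply: card_pairs_ge; rewrite (cardsD1 a) in C2; case: (a \in C) C2; lia.
Qed.

Lemma cardsD1_ge A a : #|A|.-1 <= #|A :\ a|.
Proof. by rewrite (cardsD1 a A); case: (a \in A) => /=; lia. Qed.

Lemma card_reps3 A B C : 1 < #|C| ->
  #|A| * (#|B|.-1 * #|C|.-2) <= #|reps A B C|.
Proof.
move=> C2; apply: leq_trans (card_reps_ge _ _ C2).
rewrite -sum_nat_const; apply: leq_sum => a _.
have := cardsD1_ge B a; have := cardsD1_ge C a; nia.
Qed.

(** Three equal sets of size 3 have only 6 systems of representatives. An element
p of A outside B and C, and an element q of B outside A and C, more than double
this number: p can be completed in at least 7 ways, and each of the other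
elements of A in at least 3 ways. *)
Lemma card_reps_private A B C p q :
    2 < #|A| -> 2 < #|B| -> 2 < #|C| ->
    p \in A :\: (B :|: C) -> q \in B :\: (A :|: C) ->
  12 <= #|reps A B C|.
Proof.
rewrite !inE !negb_or => A3 B3 C3 /andP[/andP[pB pC] pA] /andP[/andP[qA qC] qB].
apply: leq_trans (card_reps_ge _ _ (ltnW C3)).
have nsub a : a \in A -> ~~ (B :\ a \subset C :\ a).
  move=> aA; apply/subsetPn; exists q; rewrite !inE ?(negPf qC) ?andbF // qB.
  rewrite andbT.
  by apply: contraNneq qA => ->.
rewrite (big_setD1 p) //= nsub //.
have -> : B :\ p = B by apply/setDidPl; rewrite disjoint_sym disjoints1.
have -> : C :\ p = C by apply/setDidPl; rewrite disjoint_sym disjoints1.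
have : \sum_(a in A :\ p) 3 <= \sum_(a in A :\ p)
   (#|B :\ a| * (#|C :\ a|.-1) + ~~ (B :\ a \subset C :\ a)).
  apply: leq_sum => a; rewrite !inE => /andP[_ aA]; rewrite nsub //.
  have := cardsD1_ge B a; have := cardsD1_ge C a; nia.
rewrite sum_nat_const; have := cardsD1_ge A p; nia.
Qed.

Lemma card_reps_diag A : #|reps A A A| = #|A| ^_ 3.
Proof.
rewrite card_reps; under eq_bigr => a aA.
  under eq_bigr => b.
    rewrite !inE => /andP[ba bA].
    have -> : #|A :\ a :\ b| = #|A|.-2.
      by rewrite (cardsD1 a A) aA (cardsD1 b (A :\ a)) !inE ba bA.
    over.
  rewrite sum_nat_const (_ : #|A :\ a| = #|A|.-1); last by rewrite (cardsD1 a A) aA.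
  over.
by rewrite sum_nat_const !ffactnS ffactn0 muln1.
Qed.

Lemma card_reps_cube D : (#|D| - 2) ^ 3 <= #|reps D D D|.
Proof.
have [le2|lt2] := leqP #|D| 2; first by move: le2; rewrite -subn_eq0 => /eqP->.
apply: leq_trans (card_reps3 _ _ (ltnW lt2)); rewrite !expnS expn0 muln1.
by apply: leq_mul; [|apply: leq_mul]; lia.
Qed.

End Representatives.

(** * Hexagons *)

Section Hexagons.
Variables (V : finType) (G : sgraph V).

(** The closed walk x a y b z c through six distinct vertices, stored as its two
alternating triples X = (x, y, z) and U = (a, b, c): the arguments below fix X
and count the triples U. *)
Definition hex (X U : V * V * V) : bool :=
  let: (x, y, z) := X in let: (a, b, c) := U in
  [&& uniq [:: x; a; y; b; z; c], adj G x a, adj G a y, adj G y b, adj G b z,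
      adj G z c & adj G c x].

Lemma hexE x y z a b c : hex (x, y, z) (a, b, c) =
  [&& uniq [:: x; a; y; b; z; c], adj G x a, adj G a y, adj G y b, adj G b z,
      adj G z c & adj G c x].
Proof. by []. Qed.

Definition hexes : {set (V * V * V) * (V * V * V)} := [set p | hex p.1 p.2].

Definition hex_of (f : {ffun 'I_6 -> V}) : (V * V * V) * (V * V * V) :=
  let v k := f (inord k) in ((v 0, v 2, v 4), (v 1, v 3, v 5)).

Definition ffun_of_hex (p : (V * V * V) * (V * V * V)) : {ffun 'I_6 -> V} :=
  let: ((x, y, z), (a, b, c)) := p in
  [ffun i : 'I_6 => nth x [:: x; a; y; b; z; c] i].

Lemma hex_ofK : cancel hex_of ffun_of_hex.
Proof.
move=> f; apply/ffunP => i; rewrite ffunE /=.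
case: i => [[|[|[|[|[|[|k]]]]]] lt_k] //=; congr (f _); apply: val_inj;
  by rewrite /= inordK.
Qed.

Lemma ffun_of_hexK : cancel ffun_of_hex hex_of.
Proof. by case=> -[[x y] z] [[a b] c]; rewrite /hex_of !ffunE !inordK. Qed.

Lemma hexes_embeddings : hexes = hex_of @: embeddings (cycle_graph 6) G.
Proof.
apply/setP => p; rewrite -[p in RHS]ffun_of_hexK (mem_imset _ _ (can_inj hex_ofK)).
case: p => -[[x y] z] [[a b] c]; rewrite inE hexE.
apply/idP/cycle_embeddingP.
  case/andP=> uniq6 adj6; split.
    move=> i j; rewrite !ffunE => /eqP; rewrite nth_uniq //.
    by move/eqP/val_inj.
  move=> i; rewrite !ffunE; case: i => [[|[|[|[|[|[|k]]]]]] lt_k] //=;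
    by case/and5P: adj6 => ? ? ? ? /andP[].
case=> f_inj fadj; apply/andP; split.
  apply/(uniqP x) => i j lti ltj eqij.
  have := f_inj (Ordinal lti) (Ordinal ltj); rewrite !ffunE => /(_ eqij).
  by case.
have F (k : nat) (lt_k : k < 6) := fadj (Ordinal lt_k).
have := F 0 isT; have := F 1 isT; have := F 2 isT; have := F 3 isT.
by have := F 4 isT; have := F 5 isT; rewrite !ffunE /= => -> -> -> -> -> ->.
Qed.

(** Every 6-cycle is traversed in 12 ways, by its starting point and direction. *)
Lemma card_hexes : #|hexes| = 12 * ncopies (cycle_graph 6) G.
Proof.
rewrite hexes_embeddings (card_imset _ (can_inj hex_ofK)) card_embeddings.
by rewrite (card_cycle_aut 3).
Qed.

Lemma card_hexesE : #|hexes| = \sum_X #|[set U | hex X U]|.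
Proof. exact: (card_set_pair hex). Qed.

Lemma reps_sub_hex x y z (A B C : {set V}) :
    uniq [:: x; y; z] ->
    A \subset cn G x y :\ z -> B \subset cn G y z :\ x -> C \subset cn G z x :\ y ->
  {subset reps A B C <= [set U | hex (x, y, z) U]}.
Proof.
move=> xyz /subsetP sA /subsetP sB /subsetP sC [[a b] c].
rewrite [in X in X -> _]inE in_set hexE => /and4P[/sA + /sB + /sC +].
rewrite !inE /= => /and3P[az xa ya] /and3P[bx yb zb] /and3P[cy zc xc] abc.
rewrite xa (adj_sym G a y) ya yb (adj_sym G b z) zb zc (adj_sym G c x) xc !andbT.
move: abc xyz (adj_neq xa) (adj_neq ya) (adj_neq yb) (adj_neq zb) (adj_neq zc).
have xc' := adj_neq xc.
rewrite /= !inE !negb_or !andbT => /andP[/andP[ab ac] bc] /andP[/andP[xy xz] yz].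
move=> xa' ya' yb' zb' zc'.
rewrite xa' xy xz xc' ab az ac yb' yz bc zc' (eq_sym x b) bx.
by rewrite (eq_sym a y) ya' (eq_sym y c) cy (eq_sym b z) zb'.
Qed.

End Hexagons.

(** * Common neighbours in saturated graphs *)

Lemma F_freeE (U V : finType) (F : sgraph U) (G : sgraph V) :
  F_free F G = (embeddings F G == set0).
Proof. by rewrite /F_free copiesE imset_eq0. Qed.

Lemma complete_embeddingP (m : nat) (V : finType) (G : sgraph V)
    (f : {ffun 'I_m -> V}) :
  reflect (injective f /\ forall i j, i != j -> adj G (f i) (f j))
          (f \in embeddings (complete_graph m) G).
Proof.
rewrite inE; apply: (iffP andP) => -[/injectiveP f_inj fG]; split => //.
  move=> i j neq_ij; have := forall_inP fG [set i; j].
  by rewrite !inE cards2 neq_ij imsetU1 imset_set1; apply.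
apply/forall_inP => e; rewrite !inE /= => /cards2P[i [j [neq_ij ->]]].
by rewrite imsetU1 imset_set1; apply: fG.
Qed.

Section Saturated.
Variables (V : finType) (G : sgraph V).

Lemma adj_add_edge x y u v :
  adj (add_edge G x y) u v = (adj G u v || ([set u; v] == [set x; y]) && (u != v)).
Proof.
rewrite /adj !inE cards2; case: (eqVneq u v) => [->|neq] /=.
  by rewrite !andbF orbF; symmetry; apply: adj_irr.
by rewrite !andbT orbC.
Qed.

(** The clique on m + 2 vertices created by the edge xy must contain both x and y,
so its other m vertices are common neighbours of x and y. *)
Lemma saturated_cn m x y : saturated (complete_graph m.+2) G ->
  x != y -> ~~ adj G x y -> m <= #|cn G x y|.
Proof.
case/andP=> Gfree /forallP/(_ x)/forallP/(_ y)/implyP sat_xy neq_xy nadj.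
have := sat_xy; rewrite neq_xy nadj F_freeE => /(_ isT)/set0Pn[f].
case/complete_embeddingP => f_inj f_adj.
have /existsP[i /existsP[j /andP[neq_ij /eqP fij]]] :
    [exists i, exists j, (i != j) && ([set f i; f j] == [set x; y])].
  apply: contraLR Gfree; rewrite negb_exists => /forallP nex.
  rewrite F_freeE; apply/set0Pn; exists f; apply/complete_embeddingP; split=> //.
  move=> i j neq_ij; have := f_adj i j neq_ij; rewrite adj_add_edge.
  have := nex i; rewrite negb_exists => /forallP/(_ j); rewrite neq_ij /=.
  by move/negPf->; rewrite orbF.
pose K := ~: [set i; j].
have -> : m = #|f @: K|.
  have := cardsC [set i; j]; rewrite (card_imset _ f_inj) cards2 neq_ij card_ord.
  by case.
apply: subset_leq_card; apply/subsetP => _ /imsetP[k kK ->].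
suff [xk yk] : adj G x (f k) /\ adj G y (f k) by rewrite !inE xk yk.
have hk l : l \in [set i; j] -> adj G (f l) (f k).
  move=> lij; have neq_lk : l != k.
    by apply: contraTneq kK => <-; rewrite inE negbK.
  have := f_adj _ _ neq_lk; rewrite adj_add_edge => /orP[//|/andP[/eqP]].
  move/setP/(_ (f k)); rewrite -fij set22 !inE !(inj_eq f_inj) => kij.
  by move: kK; rewrite !inE -kij.
have xy u : u \in [set x; y] -> adj G u (f k).
  rewrite -fij !inE => /orP[]/eqP->; apply: hk; rewrite ?set21 ?set22 //.
by split; apply: xy; rewrite ?set21 ?set22.
Qed.

End Saturated.

(** * Graphs with few cherries *)

Section TypicalTriples.
Variables (V : finType) (G : sgraph V) (L : {set V}).

Definition within (U : V * V * V) := [&& U.1.1 \in L, U.1.2 \in L & U.2 \in L].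

Definition hex_in (X : V * V * V) := [set U | hex G X U & within U].
Definition hex_out (X : V * V * V) := [set U | hex G X U & ~~ within U].

Definition typical (X : V * V * V) : bool :=
  let: (x, y, z) := X in
  [&& uniq [:: x; y; z], ~~ adj G x y, ~~ adj G y z, ~~ adj G z x &
   [forall v in L, ~~ [&& adj G x v, adj G y v & adj G z v]]].

(** A 6-cycle with alternating triples X and U is seen from X and from U. It is
counted with weight 2 when U leaves L, since it is then seen from only one
triple inside L, and with weight 1 otherwise. *)
Lemma typical_hex X : saturated (complete_graph 5) G -> typical X ->
  12 <= 2 * #|hex_out X| + #|hex_in X|.
Proof.
case: X => [[x y] z] Gsat /and5P[xyz nxy nyz nzx /forall_inP nL].
have /and3P[xy xz yz] : [&& x != y, x != z & y != z].
  by move: xyz; rewrite /= !inE negb_or andbT andbA.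
have zx : z != x by rewrite eq_sym.
pose A := cn G x y; pose B := cn G y z; pose C := cn G z x.
have A3 : 2 < #|A| by apply: saturated_cn.
have B3 : 2 < #|B| by apply: saturated_cn.
have C3 : 2 < #|C| by apply: saturated_cn.
have sub : {subset reps A B C <= [set U | hex G (x, y, z) U]}.
  apply: reps_sub_hex => //; apply/subsetD1P; split=> //.
  - by rewrite !inE (adj_sym G x) (negPf nzx).
  - by rewrite !inE (adj_sym G y) (negPf nxy).
  - by rewrite !inE (adj_sym G z) (negPf nyz).
(* If A, B or C avoids L, every system of representatives leaves L.
   Otherwise A and B contain elements of L, and those are private because no
   vertex of L sees x, y and z. *)
have [full | notfull] :=
  boolP [|| [disjoint A & L], [disjoint B & L] | [disjoint C & L]].
  suff : 6 <= #|hex_out (x, y, z)| by lia.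
  have R6 : 6 <= #|reps A B C|.
    by apply: leq_trans (card_reps3 _ _ (ltnW C3)); nia.
  apply: leq_trans R6 _; apply: subset_leq_card; apply/subsetP => u uR.
  have := sub _ uR; rewrite !inE => ->; apply/negP => /and3P[u1 u2 u3].
  move: uR; rewrite inE => /and4P[uA uB uC _].
  have nd (D : {set V}) v : v \in D -> v \in L -> ~~ [disjoint D & L].
    by move=> vD vL; apply/pred0Pn; exists v; rewrite /= vD vL.
  by case/or3P: full; apply/negP; [apply: nd uA _|apply: nd uB _|apply: nd uC _].
suff : 12 <= #|hex_out (x, y, z)| + #|hex_in (x, y, z)| by lia.
have split_hex : #|[set U | hex G (x, y, z) U]|
                   = #|hex_in (x, y, z)| + #|hex_out (x, y, z)|.
  rewrite -(cardsID [set U | within U]); congr (_ + _); apply: eq_card => U;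
    by rewrite !inE // andbC.
rewrite addnC -split_hex; apply: leq_trans (subset_leq_card (introT subsetP sub)).
move: notfull; rewrite !negb_or.
case/and3P=> /pred0Pn[p /andP[/= pA pL]] /pred0Pn[q /andP[/= qB qL]] _.
apply: (card_reps_private A3 B3 C3 (p := p) (q := q)).
  by move: pA (nL p pL); rewrite !inE => /andP[-> ->] /=; rewrite andbT => /negPf->.
move: qB (nL q qL); rewrite !inE => /andP[-> ->] /=.
by rewrite !andbT => /negPf->.
Qed.

(** A hexagon with X inside L and U not inside L gives a second one by rotation,
with the roles of X and U exchanged; this accounts for the weight 2. *)
Lemma hexes_typical : saturated (complete_graph 5) G ->
  12 * #|[set X : V * V * V | within X & typical X]| <= #|hexes G|.
Proof.
move=> Gsat; pose rot (p : (V * V * V) * (V * V * V)) :=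
  let: ((x, y, z), (a, b, c)) := p in ((a, b, c), (y, z, x)).
have rot_inj : injective rot.
  move=> [[[x y] z] [[a b] c]] [[[x' y'] z'] [[a' b'] c']].
  by case=> -> -> -> -> -> ->.
have rot_hex p : hex G (rot p).1 (rot p).2 = hex G p.1 p.2.
  case: p => [[[x y] z] [[a b] c]]; rewrite /rot [LHS]hexE [RHS]hexE.
  rewrite -(rot_uniq 1 [:: x; a; y; b; z; c]) /rot /=; congr (_ && _).
  by case: (adj G x a); rewrite ?andbF ?andbT.
pose HL := [set p : (V * V * V) * (V * V * V) |
              hex G p.1 p.2 && (within p.1 && within p.2)].
pose HH := [set p : (V * V * V) * (V * V * V) |
              hex G p.1 p.2 && (within p.1 && ~~ within p.2)].
have big : 2 * #|HH| + #|HL| <= #|hexes G|.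
  rewrite mul2n -addnn -{2}(card_imset _ rot_inj).
  have dis1 : [disjoint rot @: HH & HL :|: HH].
    apply/pred0P => p /=; apply/negP => /andP[/imsetP[q qHH ->]].
    move: qHH; rewrite !inE => /and3P[_ _].
    have -> : within (rot q).1 = within q.2 by case: q => [[[x y] z] [[a b] c]].
    by move/negPf->; rewrite !andbF.
  have dis2 : [disjoint HH & HL].
    apply/pred0P => p /=; rewrite !inE; case: (hex _ _ _) => //=.
    by case: (within p.1); case: (within p.2).
  rewrite addnAC (addnC _ #|_ @: _|) -cardsUI (disjoint_setI0 dis2) cards0 addn0.
  rewrite setUC -cardsUI (disjoint_setI0 dis1) cards0 addn0.
  apply: subset_leq_card; apply/subsetP => p; rewrite !inE.
  case/orP=> [/imsetP[q]|/orP[]/andP[]//]; rewrite inE => /andP[hq _] ->.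
  by rewrite rot_hex.
apply: leq_trans big.
rewrite (card_set_pair (fun X U => hex G X U && (within X && ~~ within U))).
rewrite (card_set_pair (fun X U => hex G X U && (within X && within U))).
rewrite mulnC -sum_nat_const big_distrr -big_split /= big_mkcond.
apply: leq_sum => X _; rewrite inE; case: ifP => // /andP[XL /(typical_hex Gsat)].
by rewrite /hex_out /hex_in XL.
Qed.

End TypicalTriples.

Section Counting.
Variables (V : finType) (G : sgraph V).
Local Notation n := #|V|.

Lemma deg_sum x : deg G x = \sum_y adj G x y.
Proof. exact: card_sum_pred. Qed.

(** Union bound: a triple that is not typical has a vertex outside L, or two equal
or adjacent vertices, or three neighbours of a vertex of L. *)
Lemma card_typical (L : {set V}) :
  n ^ 3 <= #|[set X : V * V * V | within L X & typical G L X]|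
           + 3 * (#|~: L| * n ^ 2) + 3 * ((n + \sum_x deg G x) * n)
           + \sum_(v in L) deg G v ^ 3.
Proof.
pose near x y := (x == y) || adj G x y.
pose out x := x \notin L.
pose com x y z := \sum_(v in L) (adj G v x * adj G v y * adj G v z).
have pt x y z : 1 <= (within L (x, y, z) && typical G L (x, y, z)) +
   (out x + out y + out z) + (near x y + near y z + near z x) + com x y z.
  have [com0|com_pos] := posnP (com x y z); last by rewrite addn_gt0 com_pos orbT.
  rewrite com0 addn0 /typical /within /out /near /=.
  have -> : [forall v in L, ~~ [&& adj G x v, adj G y v & adj G z v]].
    apply/forall_inP => v vL; apply/negP => /and3P[xv yv zv].
    move/eqP: com0; rewrite sum_nat_eq0 => /forall_inP/(_ v vL).
    by rewrite !(adj_sym G v) xv yv zv.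
  rewrite !inE (eq_sym z x).
  case: (x \in L); case: (y \in L); case: (z \in L);
  case: (x == y); case: (y == z); case: (x == z);
  by case: (adj G x y); case: (adj G y z); case: (adj G z x).
have cst (F : V -> nat) c : (forall x, F x = c) -> \sum_x F x = n * c.
  by move=> Fc; rewrite (eq_bigr _ (fun x _ => Fc x)) sum_nat_const.
have outE : \sum_x out x = #|~: L|.
  by rewrite -card_sum_pred; apply: eq_card => x; rewrite !inE.
have nearE : \sum_x \sum_y near x y <= n + \sum_x deg G x.
  rewrite -[X in X + _]muln1 -sum_nat_const -big_split; apply: leq_sum => x _ /=.
  rewrite deg_sum; have -> : 1 = \sum_y (x == y).
    rewrite -card_sum_pred -(cards1 x); apply: eq_card => y.
    by rewrite !inE eq_sym.
  rewrite -big_split; apply: leq_sum => y _ /=; rewrite /near.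
  by case: (x == y); case: (adj G x y).
have comE : \sum_x \sum_y \sum_z com x y z = \sum_(v in L) deg G v ^ 3.
  rewrite /com; under eq_bigr do under eq_bigr do rewrite exchange_big.
  under eq_bigr do rewrite exchange_big.
  rewrite exchange_big; apply: eq_bigr => v _ /=.
  rewrite !expnS expn0 muln1 mulnA {1}deg_sum !big_distrl /=; apply: eq_bigr => x _.
  rewrite {1}deg_sum big_distrr big_distrl /=; apply: eq_bigr => y _.
  by rewrite deg_sum big_distrr.
have -> : n ^ 3 = \sum_(x : V) \sum_(y : V) \sum_(z : V) 1.
  by rewrite (cst _ (n ^ 2)) ?expnS // => x; rewrite (cst _ (n * 1)) ?expnS // => y;
     rewrite (cst _ 1).
rewrite card_sum_pred sum_triple.
apply: (@leq_trans (\sum_x \sum_y \sum_z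
   ((within L (x, y, z) && typical G L (x, y, z)) + (out x + out y + out z)
    + (near x y + near y z + near z x) + com x y z))).
  by do 3!(apply: leq_sum => ? _); apply: pt.
under eq_bigr do under eq_bigr do rewrite !big_split /=.
under eq_bigr do rewrite !big_split /=.
rewrite !big_split /= comE leq_add2r -!addnA leq_add2l.
have -> : \sum_x \sum_(y : V) \sum_(z : V) out x = #|~: L| * n ^ 2.
  under eq_bigr do under eq_bigr do rewrite sum_nat_const.
  under eq_bigr do rewrite sum_nat_const.
  rewrite -outE big_distrl; apply: eq_bigr => x _ /=.
  by rewrite mulnA mulnC expnS expn1.
have -> : \sum_(x : V) \sum_y \sum_(z : V) out y = #|~: L| * n ^ 2.
  under eq_bigr do under eq_bigr do rewrite sum_nat_const.
  under eq_bigr do rewrite -big_distrr outE.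
  by rewrite sum_nat_const mulnA mulnC expnS expn1.
have -> : \sum_(x : V) \sum_(y : V) \sum_z out z = #|~: L| * n ^ 2.
  under eq_bigr do under eq_bigr do rewrite outE.
  under eq_bigr do rewrite sum_nat_const.
  by rewrite sum_nat_const mulnA mulnC expnS expn1.
have n1 : \sum_x \sum_y \sum_(z : V) near x y <= (n + \sum_x deg G x) * n.
  under eq_bigr do under eq_bigr do rewrite sum_nat_const.
  under eq_bigr do rewrite -big_distrr.
  by rewrite -big_distrr /= mulnC leq_mul2r nearE orbT.
have n2 : \sum_(x : V) \sum_y \sum_z near y z <= (n + \sum_x deg G x) * n.
  by rewrite sum_nat_const mulnC leq_mul2r nearE orbT.
have n3 : \sum_x \sum_(y : V) \sum_z near z x <= (n + \sum_x deg G x) * n.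
  by rewrite exchange_big sum_nat_const mulnC leq_mul2r exchange_big nearE orbT.
rewrite !leq_add2l add0n; apply: leq_trans (leq_add n1 (leq_add n2 n3)) _.
by rewrite addnA !mulSn mul0n addn0 addnA.
Qed.

Lemma sum_deg_bound p : 2 * (p * \sum_x deg G x) <= \sum_x deg G x ^ 2 + n * p ^ 2.
Proof.
rewrite mulnA big_distrr -[n * _]sum_nat_const -big_split; apply: leq_sum => x _ /=.
rewrite addnC -mulnA; exact: (nat_Cauchy p (deg G x)).1.
Qed.

Lemma card_high p (H : {set V}) : (forall v, v \in H -> n <= p * deg G v) ->
  #|H| * n ^ 2 <= p ^ 2 * \sum_x deg G x ^ 2.
Proof.
move=> Hhigh; rewrite -sum_nat_const big_distrr big_mkcond /=.
apply: leq_sum => v _; case: ifP => // vH.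
by rewrite -expnMn leq_exp2r ?Hhigh.
Qed.

Lemma sum_deg3_low p (L : {set V}) : (forall v, v \in L -> p * deg G v <= n) ->
  p * \sum_(v in L) deg G v ^ 3 <= n * \sum_x deg G x ^ 2.
Proof.
move=> Llow; rewrite !big_distrr /= big_mkcond; apply: leq_sum => v _.
by case: ifP => // vL; rewrite expnS mulnA leq_mul2r Llow ?orbT.
Qed.

(** Take for L the vertices of degree at most n / p, with K and p fixed while n grows.
There are O(1) vertices outside L, O(n^2 / p) edges, and O(n^3 / p) triples with a
common neighbour in L, so all but O(n^3 / p) triples are typical. *)
Lemma hexes_few_cherries K p : saturated (complete_graph 5) G ->
    \sum_x deg G x ^ 2 <= K * n ^ 2 ->
  p * (12 * n ^ 3) <= p * #|hexes G|
    + 12 * (3 * K * n ^ 3 + (3 * p ^ 3 * K + 6 * p ^ 2) * n ^ 2).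
Proof.
move=> Gsat Kbound; have [->|p_gt0] := posnP p; first by rewrite !mul0n.
pose L := [set v | p * deg G v <= n].
have hH : forall v, v \in ~: L -> n <= p * deg G v.
  by move=> v; rewrite !inE -ltnNge => /ltnW.
have hL : forall v, v \in L -> p * deg G v <= n by move=> v; rewrite inE.
have := hexes_typical L Gsat; have := card_typical L.
have := card_high hH; have := sum_deg3_low hL; have := sum_deg_bound p.
move: #|~: L| #|hexes G| Kbound.
move: #|[set X | _]| (\sum_(v in L) _) (\sum_x deg G x ^ 2) (\sum_x deg G x).
move: n => m T D3 S2 S1 H X S2K S1S2 D3S2 HS2 m3 TX.
rewrite (expnSr p 2) (expnSr m 2) in m3 *.
have e1 : m * S2 <= m * (K * m ^ 2) by rewrite leq_mul2l S2K orbT.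
have e2 : p * (H * m ^ 2) <= p * (p ^ 2 * (K * m ^ 2)).
  by rewrite leq_mul2l (leq_trans HS2) ?orbT // leq_mul2l S2K orbT.
have e3 : m * (2 * (p * S1)) <= m * (S2 + m * p ^ 2) by rewrite leq_mul2l S1S2 orbT.
have e4 : p * (m ^ 2 * m) <= p * (T + 3 * (H * m ^ 2) + 3 * ((m + S1) * m) + D3).
  by rewrite leq_mul2l m3 orbT.
have e5 : p * (12 * T) <= p * X by rewrite leq_mul2l TX orbT.
have e6 : p * (m * m) <= p ^ 2 * (m * m).
  by rewrite leq_mul2r expnS expn1 leq_pmulr ?orbT.
rewrite -[m ^ 2]/(m * m) -[p ^ 2]/(p * p) in e1 e2 e3 e4 e5 e6 *.
lia.
Qed.

End Counting.

(** * Graphs with many cherries *)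

Section ManyCherries.
Variables (V : finType) (G : sgraph V).
Local Notation n := #|V|.

Lemma sum_cn : \sum_x \sum_y #|cn G x y| = \sum_v deg G v ^ 2.
Proof.
have cnE x y : #|cn G x y| = \sum_v adj G v x * adj G v y.
  rewrite card_sum_pred; apply: eq_bigr => v _.
  by rewrite !inE mulnb !(adj_sym G v).
under eq_bigr do under eq_bigr do rewrite cnE.
under eq_bigr do rewrite exchange_big.
rewrite exchange_big; apply: eq_bigr => v _ /=.
rewrite expnS expn1 {1}deg_sum big_distrl /=; apply: eq_bigr => x _.
by rewrite deg_sum big_distrr.
Qed.

(** Each common neighbour of x and y extends to two hexagons: z has at least three
common neighbours with each of x and y, leaving two choices and then one. *)
Lemma cherry_hex x y z : saturated (complete_graph 5) G ->
    x != y -> z != x -> z != y -> ~~ adj G x z -> ~~ adj G y z ->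
  2 * #|cn G x y| <= #|[set U | hex G (x, y, z) U]|.
Proof.
move=> Gsat xy zx zy nxz nyz.
have C3 : 2 < #|cn G y z| by apply: saturated_cn; rewrite // eq_sym.
have D3 : 2 < #|cn G z x| by apply: saturated_cn; rewrite // adj_sym.
have sub : {subset reps (cn G x y) (cn G y z) (cn G z x)
            <= [set U | hex G (x, y, z) U]}.
  apply: reps_sub_hex.
  - by rewrite /= !inE negb_or xy !(eq_sym _ z) zx zy.
  - by apply/subsetD1P; split=> //; rewrite !inE (negPf nxz).
  - by apply/subsetD1P; split=> //; rewrite !inE (adj_sym G z) (negPf nxz) andbF.
  - by apply/subsetD1P; split=> //; rewrite !inE (adj_sym G z) (negPf nyz).
apply: leq_trans (subset_leq_card (introT subsetP sub)).
apply: leq_trans (card_reps3 _ _ (ltnW D3)); rewrite mulnC leq_mul2l.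
by apply/orP; right; apply: (@leq_mul 2 1); lia.
Qed.

Lemma card_far x y : n - (deg G x + deg G y) - 2 <=
  #|[set z | [&& z != x, z != y, ~~ adj G x z & ~~ adj G y z]]|.
Proof.
have -> : [set z | [&& z != x, z != y, ~~ adj G x z & ~~ adj G y z]]
          = ~: ([set x; y] :|: (nbr G x :|: nbr G y)).
  by apply/setP => z; rewrite !inE !negb_or -andbA.
rewrite -(cardsC ([set x; y] :|: (nbr G x :|: nbr G y))).
have := (leq_card_setU [set x; y] (nbr G x :|: nbr G y)).1.
have := (leq_card_setU (nbr G x) (nbr G y)).1; rewrite cards2 /deg.
by case: (x != y) => /=; lia.
Qed.

(** Vertices of degree below n / 3 leave about n / 3 choices of z for each cherry
with both ends outside B. The cherries with an end in B number at most
2 * #|B| * n ^ 2, and those with two equal ends at most n ^ 2. *)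
Lemma hexes_cherries (B : {set V}) : saturated (complete_graph 5) G ->
    (forall v, v \notin B -> 3 * deg G v < n) ->
  2 * (n - 4) * (\sum_v deg G v ^ 2) <=
    3 * #|hexes G| + 2 * (n - 4) * ((2 * #|B| + 1) * n ^ 2).
Proof.
move=> Gsat Blow.
pose good x y := [&& x != y, x \notin B & y \notin B].
have cnn x y : #|cn G x y| <= n by apply: max_card.
have main : 2 * (n - 4) * (\sum_x \sum_y good x y * #|cn G x y|) <= 3 * #|hexes G|.
  rewrite card_hexesE sum_triple !big_distrr; apply: leq_sum => x _ /=.
  rewrite !big_distrr; apply: leq_sum => y _ /=.
  rewrite /good; case: and3P => [[xy xB yB]|_]; last by rewrite mul0n muln0.
  rewrite mul1n.
  pose far := [set z | [&& z != x, z != y, ~~ adj G x z & ~~ adj G y z]].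
  apply: (@leq_trans (3 * (\sum_(z in far) 2 * #|cn G x y|))).
    rewrite sum_nat_const; have := card_far x y; rewrite -/far.
    have := Blow x xB; have := Blow y yB; move: #|far| => t *.
    have : n - 4 <= 3 * t by lia.
    move/(leq_mul (leqnn (2 * #|cn G x y|))).
    by move: (n - 4) => m; lia.
  rewrite leq_mul2l /= big_mkcond /=; apply: leq_sum => z _.
  by case: ifP => //; rewrite inE => /and4P[zx zy nxz nyz]; apply: cherry_hex.
apply: leq_trans (leq_add main (leqnn _)); rewrite -mulnDr leq_mul2l.
apply/orP; right.
rewrite -sum_cn.
apply: (@leq_trans (\sum_x \sum_y (good x y * #|cn G x y| +
   ((x == y) * n + ((x \in B) * n + (y \in B) * n))))).
  apply: leq_sum => x _; apply: leq_sum => y _; rewrite /good.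
  have := cnn x y.
  by case: (x == y); case: (x \in B); case: (y \in B) => /=; lia.
under eq_bigr do rewrite !big_split /=.
rewrite !big_split /= leq_add2l.
have e1 : \sum_x \sum_(y : V) (x == y) * n = n ^ 2.
  rewrite (eq_bigr (fun=> n)) ?sum_nat_const ?mulnn // => x _.
  rewrite -big_distrl -card_sum_pred /=.
  rewrite (_ : [set y | x == y] = [set x]) ?cards1 ?mul1n //.
  by apply/setP => y; rewrite !inE eq_sym.
have e2 : \sum_x \sum_(y : V) (x \in B) * n = #|B| * n ^ 2.
  under eq_bigr do rewrite sum_nat_const.
  by rewrite -big_distrr -big_distrl -card_sum_pred /= cardsE mulnCA.
have e3 : \sum_(x : V) \sum_y (y \in B) * n = #|B| * n ^ 2.
  under eq_bigr do rewrite -big_distrl -card_sum_pred.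
  by rewrite sum_nat_const cardsE mulnCA.
have -> : (2 * #|B| + 1) * n ^ 2 = n ^ 2 + (#|B| * n ^ 2 + #|B| * n ^ 2) by lia.
by apply: leq_add; rewrite ?e1 //; apply: leq_add; [rewrite -e2|rewrite -e3].
Qed.

End ManyCherries.

(** * Graphs with many vertices of high degree *)

(** The graph of the cube lies above its tangent line at t. *)
Lemma cube_tangent a t : 3 * t ^ 2 * a <= a ^ 3 + 2 * t ^ 3.
Proof.
case: (leqP a t) => [/subnKC <-|/ltnW/subnKC <-].
  move: (t - a) => d; rewrite !expnS !expn0; lia.
move: (a - t) => d; rewrite !expnS !expn0; lia.
Qed.

(** A vertex has at least T + 2 neighbours in B on average, so by convexity at least
n * T ^ 3 pairs consist of a triple of distinct vertices of B and a common
neighbour; for large T this is about n / 27 common neighbours per triple. By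
convexity again, a triple lies in order n ^ 3 hexagons on average. Both uses of
convexity go through tangent lines of the cube, at T and at a parameter s that
should be a constant fraction of n. *)
Lemma hexes_dense (V : finType) (G : sgraph V) (B : {set V}) T s :
    #|B| = 3 * T + 6 ->
    (forall v, v \in B -> #|V| <= 3 * deg G v) ->
  3 * s ^ 2 * (#|V| * T ^ 3)
    <= #|hexes G| + (2 * s ^ 3 + 6 * s ^ 2) * #|B| ^ 3.
Proof.
move=> cardB Bbig; set n := #|V|.
pose C (X : V * V * V) := nbr G X.1.1 :&: nbr G X.1.2 :&: nbr G X.2.
pose D w := nbr G w :&: B.
have hexC : \sum_(X in reps B B B) (#|C X| - 2) ^ 3 <= #|hexes G|.
  rewrite card_hexesE big_mkcond /=; apply: leq_sum => -[[x y] z] _.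
  case: ifP => //; rewrite inE /= => /and4P[_ _ _ xyz].
  apply: leq_trans (card_reps_cube _) _.
  apply: (subset_leq_card (introT subsetP _)); apply: reps_sub_hex => //.
  - apply/subsetD1P; split; last by rewrite !inE adj_irr !andbF.
    by apply/subsetP => v; rewrite !inE => /andP[/andP[-> ->]].
  - apply/subsetD1P; split; last by rewrite !inE adj_irr.
    by apply/subsetP => v; rewrite !inE => /andP[/andP[_ ->] ->].
  - apply/subsetD1P; split; last by rewrite !inE adj_irr andbF.
    by apply/subsetP => v; rewrite !inE => /andP[/andP[-> _] ->].
have repsB : #|reps B B B| <= #|B| ^ 3.
  apply: (@leq_trans #|setX (setX B B) B|); last first.
    by rewrite !cardsX !expnS expn0 muln1 mulnA.
  by apply: subset_leq_card; apply/subsetP => u; rewrite !inE => /and4P[-> -> ->].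
have CD : \sum_(X in reps B B B) #|C X| = \sum_w #|reps (D w) (D w) (D w)|.
  have CE X : #|C X| = \sum_w (w \in C X) by rewrite -card_sum_pred cardsE.
  under eq_bigr do rewrite CE.
  rewrite exchange_big; apply: eq_bigr => w _; rewrite -big_mkcondr /= sum1dep_card.
  apply: eq_card => -[[x y] z]; rewrite !inE /= !(adj_sym G w).
  case: (x \in B); case: (y \in B); case: (z \in B); case: (adj G x w);
    by case: (adj G y w); case: (adj G z w); rewrite /= ?andbT ?andbF.
have cube_sum (I : finType) (P : pred I) (F : I -> nat) t :
    3 * t ^ 2 * (\sum_(i | P i) F i)
      <= \sum_(i | P i) (F i - 2) ^ 3 + (2 * t ^ 3 + 6 * t ^ 2) * #|P|.
  rewrite mulnC -[#|P|]muln1 -sum_nat_const big_distrl big_distrr -big_split /=.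
  apply: leq_sum => i _; rewrite muln1; have := cube_tangent (F i - 2) t.
  have : F i <= F i - 2 + 2 by lia.
  move: (F i - 2) => k /(leq_mul (leqnn (3 * t ^ 2))).
  rewrite mulnDr; lia.
have sumD : 3 * \sum_w #|D w| >= #|B| * n.
  have -> : \sum_w #|D w| = \sum_(v in B) deg G v.
    have DE w : #|D w| = \sum_(v in B) adj G v w.
      rewrite card_sum_pred [RHS]big_mkcond; apply: eq_bigr => v _.
      by rewrite [v \in nbr _ _]inE adj_sym andbC; case: ifP.
    under eq_bigr do rewrite DE.
    by rewrite exchange_big; apply: eq_bigr => v _; rewrite deg_sum.
  by rewrite big_distrr -sum_nat_const; apply: leq_sum => v; apply: Bbig.
have nT3 : n * T ^ 3 <= \sum_(X in reps B B B) #|C X|.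
  rewrite CD; apply: (@leq_trans (\sum_w (#|D w| - 2) ^ 3)); last first.
    by apply: leq_sum => w _; apply: card_reps_cube.
  have Tn : T * n <= \sum_w (#|D w| - 2).
    have : \sum_w #|D w| <= \sum_w (#|D w| - 2) + n * 2.
      by rewrite -sum_nat_const -big_split; apply: leq_sum => w _ /=; lia.
    by move: sumD; rewrite cardB; lia.
  rewrite -(leq_add2r (2 * n * T ^ 3)).
  have : 3 * T ^ 2 * (T * n) <= \sum_w (#|D w| - 2) ^ 3 + 2 * n * T ^ 3.
    apply: leq_trans (leq_mul (leqnn _) Tn) _.
    rewrite big_distrr (mulnC 2 n) -mulnA -sum_nat_const -big_split.
    by apply: leq_sum => w _; apply: cube_tangent.
  by rewrite !expnS !expn0; lia.
apply: leq_trans (leq_mul (leqnn (3 * s ^ 2)) nT3) _.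
apply: leq_trans (cube_sum _ (mem (reps B B B)) (fun X => #|C X|) s) _.
by apply: leq_add hexC _; rewrite leq_mul2l repsB orbT.
Qed.

(** * The lower bound *)

Lemma subset_of_card (T : finType) (A : {set T}) k : k <= #|A| ->
  exists2 B : {set T}, B \subset A & #|B| = k.
Proof.
move=> le_k; exists [set x in take k (enum A)].
  by apply/subsetP => x; rewrite inE => /mem_take; rewrite mem_enum.
rewrite cardsE (card_uniqP _) ?take_uniq ?enum_uniq //.
by rewrite size_takel // -cardE.
Qed.

(** The estimate for T = 30, so that 96 = 3 * T + 6, and s of about n / 40. *)
Lemma hexes_many_high_degree (V : finType) (G : sgraph V) :
    1600 <= #|V| -> 96 <= #|[set v | #|V| <= 3 * deg G v]| ->
  12 * #|V| ^ 3 <= #|hexes G|.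
Proof.
move=> n_big /subset_of_card[B /subsetP sB cardB].
have Bhigh v : v \in B -> #|V| <= 3 * deg G v by move/sB; rewrite inE.
have := hexes_dense (T := 30) (#|V| %/ 40) cardB Bhigh.
have s40 : 40 <= #|V| %/ 40 by rewrite leq_divRL.
have nE : #|V| = #|V| %/ 40 * 40 + #|V| %% 40 by apply: divn_eq.
have : #|V| %% 40 < 40 by rewrite ltn_mod.
rewrite cardB; move: #|V| (#|V| %/ 40) (#|V| %% 40) #|hexes G| s40 nE n_big => n s r h.
move=> s40 nE n_big r40; rewrite !expnS !expn0 !muln1 => dense.
have n41 : n <= 41 * s by lia.
have n40 : 40 * s <= n by lia.
have e1 : s * s * (40 * s) <= s * s * n by rewrite leq_mul2l n40 orbT.
have e2 : n * (n * n) <= 41 * s * (41 * s * (41 * s)) by rewrite !leq_mul.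
have e3 : 40 * (s * s) <= s * (s * s) by rewrite leq_mul2r s40 orbT.
lia.
Qed.

(** Three cases: at least 96 vertices of degree at least n / 3; fewer, but more
than K * n ^ 2 cherries; at most K * n ^ 2 cherries. *)
Lemma many_copies (k : nat) : exists n0, forall (V : finType) (G : sgraph V),
    n0 <= #|V| -> saturated (complete_graph 5) G ->
  k * #|V| ^ 3 <= k * ncopies (cycle_graph 6) G + #|V| ^ 3.
Proof.
(* The 2 * 96 + 1 absorbs the cherries lost in hexes_cherries; the remaining
   36 * n ^ 2 cherries give 24 * (n - 4) * n ^ 2 hexagons. *)
have [K K_gt0 KE] : exists2 K, 0 < K & K = 2 * 96 + 37 by exists (2 * 96 + 37).
(* With this p the error 3 * K / p is 1 / (2 * k), which leaves as much for the
   term in n ^ 2. *)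
pose p := 6 * K * k; pose c := 3 * p ^ 3 * K + 6 * p ^ 2.
exists (1600 + c) => V G n_big Gsat.
have := card_hexes G; set N := ncopies _ _ => hexN.
have many : 12 * #|V| ^ 3 <= #|hexes G| -> k * #|V| ^ 3 <= k * N + #|V| ^ 3.
  rewrite hexN leq_mul2l /= => le_N.
  by apply: leq_trans (leq_addr _ _); rewrite leq_mul2l le_N orbT.
have n1600 : 1600 <= #|V| by lia.
pose B := [set v | #|V| <= 3 * deg G v].
have [B96 | B96] := leqP 96 #|B|; first exact/many/hexes_many_high_degree.
have [sum_small | sum_big] := leqP (\sum_v deg G v ^ 2) (K * #|V| ^ 2).
  have := hexes_few_cherries p Gsat sum_small; rewrite hexN -/c.
  have : c * #|V| ^ 2 <= #|V| ^ 3 by rewrite expnS leq_mul2r; lia.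
  move=> cn few.
  have {few} : 6 * K * (k * #|V| ^ 3) <= 6 * K * (k * N + #|V| ^ 3).
    by rewrite /p in few; nia.
  by rewrite leq_mul2l; lia.
apply: many.
have Blow v : v \notin B -> 3 * deg G v < #|V| by rewrite inE -ltnNge.
have := hexes_cherries Gsat Blow.
move: #|V| (\sum_v _) #|B| #|hexes G| n1600 B96 sum_big => n S b h n1600 b96 S_big bound.
have e1 : 2 * (n - 4) * (K * n ^ 2) <= 3 * h + 2 * (n - 4) * (193 * n ^ 2).
  apply: leq_trans (leq_trans bound _); first by rewrite leq_mul2l (ltnW S_big) orbT.
  by rewrite leq_add2l leq_mul2l leq_mul2r; lia.
have n4 : n <= 2 * (n - 4) by lia.
have e2 : n * (36 * n ^ 2) <= 2 * (n - 4) * (36 * n ^ 2) by rewrite leq_mul2r n4 orbT.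
rewrite KE in e1; rewrite expnS; lia.
Qed.

(** * The upper bound *)

Section TriangleJoin.
Variable m : nat.
Local Notation n := (3 + m).

Definition core : {set 'I_n} := [set i : 'I_n | i < 3].
(** The join of a triangle and an independent set on m vertices. *)
Definition K3_join : sgraph 'I_n :=
  graph_of [set e : {set 'I_n} | ~~ [disjoint e & core]].

Lemma adj_K3_join x y :
  adj K3_join x y = (x != y) && ((x \in core) || (y \in core)).
Proof.
rewrite /adj !inE cards2 andbC; congr (_ && _); first by case: (x != y).
apply/pred0Pn/orP => [[z]|].
  by rewrite !inE => /andP[/orP[]/eqP-> ?]; [left|right].
by case=> ?; [exists x|exists y]; rewrite !inE /= eqxx ?orbT.
Qed.

Lemma card_core : #|core| = 3.
Proof.
suff -> : core = lshift m @: [set: 'I_3].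
  by rewrite (card_imset _ (@lshift_inj 3 m)) cardsT card_ord.
apply/setP => i; rewrite inE; apply/idP/imsetP => [lt_i|[j _ ->]]; last exact: (ltn_ord j).
by exists (Ordinal lt_i) => //; apply: val_inj.
Qed.

Lemma card_not_core : #|~: core| = m.
Proof. by have := cardsC core; rewrite card_core card_ord => /addnI. Qed.

Lemma K3_join_free : F_free (complete_graph 5) K3_join.
Proof.
rewrite F_freeE; apply/set0Pn => -[f /complete_embeddingP[f_inj f_adj]].
pose I := [set i | f i \in core].
have I3 : #|I| <= 3.
  rewrite -(card_imset _ f_inj) -[X in _ <= X]card_core; apply: subset_leq_card.
  by apply/subsetP => _ /imsetP[i iI ->]; rewrite inE in iI.
have : 1 < #|~: I| by have := cardsC I; rewrite card_ord; lia.
case/card_gt1P => i [j [iI jI neq]]; have := f_adj i j neq.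
by rewrite adj_K3_join; move: iI jI; rewrite !inE => /negPf-> /negPf->; rewrite andbF.
Qed.

Lemma K3_join_saturated : saturated (complete_graph 5) K3_join.
Proof.
rewrite /saturated K3_join_free; apply/forallP => x; apply/forallP => y.
apply/implyP => /andP[neq]; rewrite -/(adj K3_join x y) adj_K3_join neq /= negb_or.
case/andP=> xC yC; rewrite F_freeE; apply/set0Pn.
pose c k (lt_k : k < 3) : 'I_n := lshift m (Ordinal lt_k).
pose s := [:: x; y; @c 0 isT; @c 1 isT; @c 2 isT].
have cC k lt_k : @c k lt_k \in core by rewrite inE.
have uniq_s : uniq s.
  have ne u k lt_k : u \notin core -> u != @c k lt_k by apply: contraNneq => ->.
  by rewrite /s /= !inE !negb_or neq !ne.
exists [ffun i : 'I_5 => nth x s i]; apply/complete_embeddingP.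
have f_inj : injective (fun i : 'I_5 => nth x s i).
  by move=> i j /eqP; rewrite nth_uniq // => /eqP/val_inj.
split=> [i j|i j neq_ij]; rewrite !ffunE; first exact: f_inj.
have : nth x s i != nth x s j by rewrite (inj_eq f_inj).
rewrite adj_add_edge adj_K3_join => ->; rewrite /= andbT.
case: i j neq_ij => [[|[|[|[|[|i]]]]] lt_i] [[|[|[|[|[|j]]]]] lt_j] //= _;
  by rewrite ?cC ?orbT ?eqxx ?orbT // setUC eqxx orbT.
Qed.

(** The core covers all edges and a hexagon has no vertex cover of size 3 other
than its two alternating triples. *)
Lemma hexes_K3_join : hexes K3_join \subset
  setX (reps core core core) (reps (~: core) (~: core) (~: core)) :|:
  setX (reps (~: core) (~: core) (~: core)) (reps core core core).
Proof.
apply/subsetP => -[[[x y] z] [[a b] c]]; rewrite inE hexE => /andP[u6 adj6].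
have count3 : count (mem core) [:: x; a; y; b; z; c] <= 3.
  rewrite -size_filter -[X in _ <= X]card_core cardE.
  apply: uniq_leq_size; rewrite ?filter_uniq //.
  by move=> v; rewrite mem_filter mem_enum => /andP[].
have uX : uniq [:: x; y; z].
  apply: subseq_uniq u6; apply/subseqP.
  by exists [:: true; false; true; false; true; false].
have uU : uniq [:: a; b; c].
  apply: subseq_uniq u6; apply/subseqP.
  by exists [:: false; true; false; true; false; true].
rewrite inE !in_setX !(@in_set _ _ (_, _, _)).
rewrite ![(_, _).1]/= ![(_, _).2]/= uX uU !in_setC !andbT.
have cov u v : adj K3_join u v -> (u \in core) || (v \in core).
  by rewrite adj_K3_join => /andP[].
case/and5P: adj6 => /cov + /cov + /cov + /cov + /andP[/cov + /cov].
move: count3; rewrite [count _ _]/=.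
by case: (x \in core); case: (a \in core); case: (y \in core); case: (b \in core);
   case: (z \in core); case: (c \in core).
Qed.

Lemma ncopies_K3_join : ncopies (cycle_graph 6) K3_join <= 6 * 'C(m, 3).
Proof.
suff : #|hexes K3_join| <= 12 * (6 * 'C(m, 3)) by rewrite card_hexes leq_mul2l.
apply: leq_trans (subset_leq_card hexes_K3_join) _.
apply: leq_trans (leq_card_setU _ _).1 _.
rewrite !cardsX !card_reps_diag card_core card_not_core ffactnn -bin_ffact.
by rewrite (_ : 3`! = 6) //; lia.
Qed.

End TriangleJoin.

Lemma sat_C6_K5_le n : 3 <= n ->
  sat n (cycle_graph 6) (complete_graph 5) <= 6 * 'C(n - 3, 3).
Proof.
move=> /subnKC; move: (n - 3) => m <-.
exact: leq_trans (sat_min _ (K3_join_saturated m)) (ncopies_K3_join m).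
Qed.

(** * The asymptotic statement *)

From mathcomp Require Import all_classical all_reals all_analysis.
Import Order.TTheory GRing.Theory Num.Theory.
Import numFieldNormedType.Exports.
Local Open Scope classical_set_scope.
Local Open Scope ring_scope.

Lemma sat_C6_K5_ge (k : nat) : exists n0, forall n, (n0 <= n)%N ->
  (k * n ^ 3 <= k * sat n (cycle_graph 6) (complete_graph 5) + n ^ 3)%N.
Proof.
have [n0 many] := many_copies k; exists n0 => n n_ge.
have K5 : edges (complete_graph 5) != finset.set0.
  apply/set0Pn; exists [set ord0; ord_max]%SET.
  by rewrite /= !inE cards2.
have [[G Gsat <-] _] := Defs.satP (cycle_graph 6) (saturated_exists n K5).
by have := many _ G; rewrite card_ord; apply.
Qed.

Theorem theorem1p8 (R : realType) :
  (exists2 eps : nat -> R, eps @ \oo --> (0 : R) &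
     forall n : nat,
       (1 - eps n) * n%:R ^+ 3
         <= (sat n (cycle_graph 6) (complete_graph 5))%:R) /\
  (forall n : nat, (3 <= n)%N ->
     (sat n (cycle_graph 6) (complete_graph 5) <= 6 * 'C(n - 3, 3))%N).
Proof.
split; last exact: sat_C6_K5_le.
pose s n : R := (sat n (cycle_graph 6) (complete_graph 5))%:R.
(* The minimum keeps eps nonnegative, so that a lower bound on sat suffices. *)
exists (fun n => 1 - Num.min 1 (s n / n%:R ^+ 3)); last first.
  move=> n; rewrite opprB addrC subrK; have [->|n_gt0] := posnP n.
    by rewrite expr0n mulr0 ler0n.
  have n3 : 0 < n%:R ^+ 3 :> R by rewrite exprn_gt0 // ltr0n.
  by rewrite -ler_pdivlMr // ge_min lexx orbT.
apply/cvgrPdist_le => e e_gt0.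
have [k ke] : exists k : nat, e^-1 <= k.+1%:R.
  exists (Num.bound e^-1); apply: le_trans (ltW (archi_boundP _)) _; last first.
    by rewrite ler_nat leqnSn.
  by rewrite invr_ge0 ltW.
have [n0 low] := sat_C6_K5_ge k.+1.
near=> n.
have n_gt0 : (0 < n)%N by near: n; exact: nbhs_infty_gt.
have n3 : 0 < n%:R ^+ 3 :> R by rewrite exprn_gt0 // ltr0n.
have min_le1 : Num.min 1 (s n / n%:R ^+ 3) <= 1 by rewrite ge_min lexx.
rewrite sub0r normrN ger0_norm ?subr_ge0 // lerBlDr -lerBlDl le_min.
rewrite lerBlDr lerDl (ltW e_gt0) /= ler_pdivlMr //.
have : (k.+1 * n ^ 3 <= k.+1 * sat n (cycle_graph 6) (complete_graph 5) + n ^ 3)%N.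
  by apply: low; near: n; exact: nbhs_infty_ge.
rewrite -(ler_nat R) natrD !(natrM _ k.+1) natrX -/(s n) => low_n.
rewrite mulrBl mul1r lerBlDr -(ler_pM2l (ltr0Sn R k)); apply: le_trans low_n _.
rewrite mulrDr lerD2l mulrA ler_peMl ?(ltW n3) //.
by rewrite mulrC -ler_pdivrMl // mulr1.
Unshelve. all: by end_near.
Qed.
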